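(* There exist no proper QGCR-lightlike submanifolds $(M,g,S(TM),S(TM^\perp))$ of an indefinite nearly Sasakian manifold $(\overline{M},\overline{\phi},\eta,\xi,\overline{g})$ with the structure vector field $\xi$ normal to $M$ (that is, $\xi\in\Gamma(TM^\perp)$ along $M$).
   Context: Notation: $\Gamma(\Xi)$ is the set of smooth sections of a vector bundle $\Xi$. Indefinite nearly Sasakian manifold: a $(2n+1)$-dimensional manifold $\overline{M}$ with a $(1,1)$-tensor $\overline{\phi}$, a vector field $\xi$, a 1-form $\eta$ and a semi-Riemannian metric $\overline{g}$ with Levi-Civita connection $\overline{\nabla}$ such that $\overline{\phi}^2=-I+\eta\otimes\xi$, $\eta(\xi)=1$, $\eta\circ\overline{\phi}=0$, $\overline{\phi}\xi=0$, $\overline{g}(\overline{\phi}X,\overline{\phi}Y)=\overline{g}(X,Y)-\eta(X)\eta(Y)$ (hence $\eta=\overline{g}(\xi,\cdot)$), and $(\overline{\nabla}_X\overline{\phi})Y+(\overline{\nabla}_Y\overline{\phi})X=2\overline{g}(X,Y)\xi-\eta(Y)X-\eta(X)Y$ for all $X,Y$. Lightlike submanifold: a submanifold $M$ of $\overline{M}$, with $g$ the induced (degenerate) metric, such that $\mathrm{Rad}\,TM=TM\cap TM^\perp$ is a smooth distribution of rank $r>0$, where $TM^\perp$ is the $\overline{g}$-orthogonal complement of $TM$ in $T\overline{M}|_M$. A screen distribution $S(TM)$ is a semi-Riemannian (non-degenerate) complement of $\mathrm{Rad}\,TM$ in $TM$; $S(TM^\perp)$ is a semi-Riemannian complement of $\mathrm{Rad}\,TM$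 in $TM^\perp$. The lightlike transversal bundle $l\mathrm{tr}(TM)$ is locally spanned by null sections $N_i$ of the orthogonal complement of $S(TM^\perp)$ in $S(TM)^\perp$ with $\overline{g}(E_i,N_j)=\delta_{ij}$, $\overline g(N_i,N_j)=0$ for a local basis $\{E_i\}$ of $\mathrm{Rad}\,TM$. Then $T\overline{M}|_M=S(TM)\perp S(TM^\perp)\perp\{\mathrm{Rad}\,TM\oplus l\mathrm{tr}(TM)\}$. QGCR-lightlike submanifold: a lightlike submanifold $(M,g,S(TM),S(TM^\perp))$ of $\overline{M}$ is Quasi Generalized Cauchy-Riemann (QGCR) if (i) there are distributions $D_1,D_2$ of $\mathrm{Rad}\,TM$ with $\mathrm{Rad}\,TM=D_1\oplus D_2$, $\overline{\phi}D_1=D_1$, $\overline{\phi}D_2\subset S(TM)$; (ii) there are subbundles $D_0,\overline{D}$ of $S(TM)$ with $S(TM)=\{\overline{\phi}D_2\oplus\overline{D}\}\perp D_0$, $\overline{\phi}D_0\subseteq D_0$, $\overline{D}=\overline{\phi}\mathcal{S}\oplus\overline{\phi}\mathcal{L}$, where $D_0$ is non-degenerate and $\mathcal{L}$, $\mathcal{S}$ are vector subbundles of $l\mathrm{tr}(TM)$ and $S(TM^\perp)$ respectively. In (ii) the symbol $\oplus$ denotes a (not necessarily orthogonal) sum of subbundles, and the summands $\overline{\phi}D_2$ and $\overline{\phi}\mathcal{L}$ are allowed to intersect. $M$ is proper if $D_0,D_1,D_2,\mathcal{S}$ are all nonzero. *)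

(* Defs.v *)
From HB Require Import structures.
From mathcomp Require Import all_boot all_order all_algebra.
From mathcomp Require Import all_classical all_reals all_analysis.
Import Order.TTheory GRing.Theory Num.Theory.
Import numFieldNormedType.Exports.

Set Implicit Arguments.
Unset Strict Implicit.
Unset Printing Implicit Defensive.

Local Open Scope classical_set_scope.
Local Open Scope ring_scope.

Section Smooth.
Variables (R : realType) (V W : normedModType R).

(* Only used with V of finite dimension and U open, where asking for all
   directional derivatives is the usual definition by partial derivatives. *)
Fixpoint is_Ck (k : nat) (U : set V) (f : V -> W) : Prop :=
  if k is k'.+1 then
    (forall x, U x -> differentiable f x) /\
    (forall v, is_Ck k' U (fun x => 'D_v f x))
  else forall x, U x -> {for x, continuous f}.

Definition smooth_on (U : set V) (f : V -> W) : Prop := forall k, is_Ck k U f.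

End Smooth.

(* [mchart i] and [minv i] are total functions; only their values on [mdom i]
   and on [mchart i @` mdom i] are meaningful.  The atlas is not assumed
   maximal.  [chart_at p] is a chosen chart around [p]: a tangent vector at [p]
   is represented by its components in that chart, so every T_p M is the space
   'rV[R]_d and a vector field is a function M -> 'rV[R]_d; see [tread]. *)
Record manifold (R : realType) (d : nat) := Manifold {
  mcarrier :> topologicalType;
  mhausdorff : hausdorff_space mcarrier;
  msecond_countable : @second_countable mcarrier;
  mindex : Type;
  mdom : mindex -> set mcarrier;
  mchart : mindex -> mcarrier -> 'rV[R]_d;
  minv : mindex -> 'rV[R]_d -> mcarrier;
  mdom_open : forall i, open (mdom i);
  mimage_open : forall i, open (mchart i @` mdom i);
  mchartK : forall i p, mdom i p -> minv i (mchart i p) = p;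
  mchart_continuous : forall i p, mdom i p -> {for p, continuous (mchart i)};
  minv_continuous : forall i x, (mchart i @` mdom i) x ->
    {for x, continuous (minv i)};
  mtransition_smooth : forall i j,
    smooth_on (mchart i @` (mdom i `&` mdom j)) (mchart j \o minv i);
  chart_at : mcarrier -> mindex;
  chart_at_dom : forall p, mdom (chart_at p) p
}.

Section Manifold.
Variables (R : realType) (d : nat) (M : manifold R d).

Definition tread (i : mindex M) (p : M) (v : 'rV[R]_d) : 'rV[R]_d :=
  'd (mchart i \o minv (chart_at p)) (mchart (chart_at p) p) v.

Definition vf_coord (i : mindex M) (X : M -> 'rV[R]_d) : 'rV[R]_d -> 'rV[R]_d :=
  fun x => tread i (minv i x) (X (minv i x)).

Definition smooth_vf (U : set M) (X : M -> 'rV[R]_d) : Prop :=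
  forall i, smooth_on (mchart i @` (mdom i `&` U)) (vf_coord i X).

Definition smooth_fun (U : set M) (h : M -> R^o) : Prop :=
  forall i, smooth_on (mchart i @` (mdom i `&` U)) (h \o minv i).

Definition dfun (h : M -> R^o) (p : M) (v : 'rV[R]_d) : R :=
  'd (h \o minv (chart_at p)) (mchart (chart_at p) p) v.

Definition lie_bracket (X Y : M -> 'rV[R]_d) (p : M) : 'rV[R]_d :=
  let i := chart_at p in
  let x := mchart i p in
  'd (vf_coord i Y) x (X p) - 'd (vf_coord i X) x (Y p).

End Manifold.

Section Forms.
Variables (R : realType) (V : vectType R).
Implicit Types (b : 'Hom(V, 'Hom(V, R^o))) (U : {vspace V}).

Definition orth b U : {vspace V} :=
  (\bigcap_(i < \dim U) lker (b (vbasis U)`_i))%VS.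

Lemma mem_orth b U w :
  reflect (forall u, u \in U -> b u w = 0) (w \in orth b U).
Proof.
have -> : (w \in orth b U) = [forall i : 'I_(\dim U), b (vbasis U)`_i w == 0].
  rewrite memvE; apply/subv_bigcapP/forallP => h i.
    by have := h i isT; rewrite -memvE memv_ker.
  by move=> _; rewrite -memvE memv_ker.
apply: (iffP forallP) => [h u uU|h i]; last first.
  by apply/eqP/h/vbasis_mem/mem_nth; rewrite size_tuple.
rewrite (coord_vbasis uU) linear_sum sum_lfunE big1 // => i _.
by rewrite linearZ scale_lfunE (eqP (h i)) scaler0.
Qed.

Definition nondegenerate_on b U : Prop := (U :&: orth b U = 0)%VS.

Definition negative_definite_on b U : Prop :=
  forall u, u \in U -> u != 0 -> (b u u : R) < 0.

Definition has_index b (nu : nat) : Prop :=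
  (exists U, negative_definite_on b U /\ \dim U = nu) /\
  (forall U, negative_definite_on b U -> (\dim U <= nu)%N).

End Forms.

Section SemiRiemannian.
Variables (R : realType) (d : nat) (M : manifold R d).

Record semi_riemannian_metric
    (g : M -> 'Hom('rV[R]_d, 'Hom('rV[R]_d, R^o))) : Prop := {
  metric_sym : forall p u v, g p u v = g p v u;
  metric_nondegenerate : forall p, nondegenerate_on (g p) fullv;
  metric_index : exists nu, forall p, has_index (g p) nu;
  metric_smooth : forall U X Y, open U -> smooth_vf U X -> smooth_vf U Y ->
    smooth_fun U (fun p => g p (X p) (Y p))
}.

(* [nabla p v Y] is the covariant derivative at [p] of the vector field [Y] in
   the direction [v]; it is constrained only when [Y] is smooth on some open
   neighbourhood of [p].  The connection thus acts on locally defined fields,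
   hence the locality axiom. *)
Record levi_civita (g : M -> 'Hom('rV[R]_d, 'Hom('rV[R]_d, R^o)))
    (nabla : M -> 'rV[R]_d -> (M -> 'rV[R]_d) -> 'rV[R]_d) : Prop := {
  nabla_local : forall (U : set M) Y Z p v, open U -> U p ->
    smooth_vf U Y -> smooth_vf U Z -> (forall q, U q -> Y q = Z q) ->
    nabla p v Y = nabla p v Z;
  nabla_smooth : forall U X Y, open U -> smooth_vf U X -> smooth_vf U Y ->
    smooth_vf U (fun p => nabla p (X p) Y);
  nabla_linear : forall (U : set M) Y p (a : R) v w, open U -> U p ->
    smooth_vf U Y ->
    nabla p (a *: v + w) Y = a *: nabla p v Y + nabla p w Y;
  nabla_add : forall (U : set M) Y Z p v, open U -> U p ->
    smooth_vf U Y -> smooth_vf U Z ->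
    nabla p v (fun q => Y q + Z q) = nabla p v Y + nabla p v Z;
  nabla_leibniz : forall (U : set M) (h : M -> R) Y p v, open U -> U p ->
    smooth_fun U h -> smooth_vf U Y ->
    nabla p v (fun q => h q *: Y q) = dfun h p v *: Y p + h p *: nabla p v Y;
  nabla_torsion_free : forall (U : set M) X Y p, open U -> U p ->
    smooth_vf U X -> smooth_vf U Y ->
    nabla p (X p) Y - nabla p (Y p) X = lie_bracket X Y p;
  nabla_metric : forall (U : set M) Y Z p v, open U -> U p ->
    smooth_vf U Y -> smooth_vf U Z ->
    dfun (fun q => g q (Y q) (Z q)) p v =
      g p (nabla p v Y) (Z p) + g p (Y p) (nabla p v Z)
}.

Definition nabla_endo (nabla : M -> 'rV[R]_d -> (M -> 'rV[R]_d) -> 'rV[R]_d)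
    (phi : M -> 'End('rV[R]_d)) (p : M) (v : 'rV[R]_d) (Y : M -> 'rV[R]_d) :
    'rV[R]_d :=
  nabla p v (fun q => phi q (Y q)) - phi p (nabla p v Y).

End SemiRiemannian.

Record nearly_sasakian (R : realType) (n : nat) := NearlySasakian {
  ns_manifold :> manifold R (2 * n).+1;
  ns_phi : ns_manifold -> 'End('rV[R]_(2 * n).+1);
  ns_eta : ns_manifold -> 'Hom('rV[R]_(2 * n).+1, R^o);
  ns_xi : ns_manifold -> 'rV[R]_(2 * n).+1;
  ns_g : ns_manifold ->
    'Hom('rV[R]_(2 * n).+1, 'Hom('rV[R]_(2 * n).+1, R^o));
  ns_nabla : ns_manifold -> 'rV[R]_(2 * n).+1 ->
    (ns_manifold -> 'rV[R]_(2 * n).+1) -> 'rV[R]_(2 * n).+1;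
  ns_phi_smooth : forall U X, open U -> smooth_vf U X ->
    smooth_vf U (fun p => ns_phi p (X p));
  ns_eta_smooth : forall U X, open U -> smooth_vf U X ->
    smooth_fun U (fun p => ns_eta p (X p));
  ns_xi_smooth : smooth_vf setT ns_xi;
  ns_metric : semi_riemannian_metric ns_g;
  ns_levi_civita : levi_civita ns_g ns_nabla;
  ns_phi2 : forall p v,
    ns_phi p (ns_phi p v) = - v + (ns_eta p v : R) *: ns_xi p;
  ns_eta_xi : forall p, ns_eta p (ns_xi p) = 1;
  ns_eta_phi : forall p v, ns_eta p (ns_phi p v) = 0;
  ns_phi_xi : forall p, ns_phi p (ns_xi p) = 0;
  ns_compatible : forall p u v,
    ns_g p (ns_phi p u) (ns_phi p v) = ns_g p u v - ns_eta p u * ns_eta p v;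
  ns_nearly : forall (U : set ns_manifold) X Y p, open U -> U p ->
    smooth_vf U X -> smooth_vf U Y ->
    nabla_endo ns_nabla ns_phi p (X p) Y + nabla_endo ns_nabla ns_phi p (Y p) X =
      (2 * ns_g p (X p) (Y p) : R) *: ns_xi p
      - (ns_eta p (Y p) : R) *: X p - (ns_eta p (X p) : R) *: Y p
}.

Section Maps.
Variables (R : realType) (d e : nat) (M : manifold R d) (N : manifold R e).
Variable f : M -> N.

Definition smooth_map : Prop :=
  continuous f /\
  forall i j, smooth_on (mchart i @` (mdom i `&` f @^-1` mdom j))
    (mchart j \o f \o minv i).

Definition dmap (p : M) : 'Hom('rV[R]_d, 'rV[R]_e) :=
  linfun ('d (mchart (chart_at (f p)) \o f \o minv (chart_at p))
             (mchart (chart_at p) p)).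

Definition injective_immersion : Prop :=
  [/\ smooth_map, injective f & forall p, lker (dmap p) = 0%VS].

Definition tangent_image (p : M) : {vspace 'rV[R]_e} := limg (dmap p).

Definition smooth_along (U : set M) (W : M -> 'rV[R]_e) : Prop :=
  forall i (j : mindex N),
    smooth_on (mchart i @` (mdom i `&` U `&` f @^-1` mdom j))
      (fun x => tread j (f (minv i x)) (W (minv i x))).

Definition subbundle_of_rank (k : nat) (D : M -> {vspace 'rV[R]_e}) : Prop :=
  forall p, exists (U : set M) (s : 'I_k -> M -> 'rV[R]_e),
    [/\ open U, U p, forall i, smooth_along U (s i) &
        forall q, U q -> basis_of (D q) [tuple s i q | i < k]].

Definition subbundle (D : M -> {vspace 'rV[R]_e}) : Prop :=
  exists k, subbundle_of_rank k D.

(* A subbundle has constant rank: as soon as one fibre is nonzero, all are. *)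
Definition nonzero_bundle (D : M -> {vspace 'rV[R]_e}) : Prop :=
  exists p, D p != 0%VS.

End Maps.

(* All bundles over M are families of subspaces of the tangent spaces of the
   ambient manifold along the immersion.  [ll_ltr] is part of the data since
   it is not determined by the two screen distributions when r > 1. *)
Record lightlike_submanifold (R : realType) (e : nat) (N : manifold R e)
    (g : N -> 'Hom('rV[R]_e, 'Hom('rV[R]_e, R^o))) := LightlikeSubmanifold {
  ll_dim : nat;
  ll_manifold :> manifold R ll_dim;
  ll_map : ll_manifold -> N;
  ll_rank : nat;
  ll_screen : ll_manifold -> {vspace 'rV[R]_e};
  ll_coscreen : ll_manifold -> {vspace 'rV[R]_e};
  ll_ltr : ll_manifold -> {vspace 'rV[R]_e};
  ll_T := tangent_image ll_map;
  ll_normal := fun x => orth (g (ll_map x)) (ll_T x);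
  ll_rad := fun x => (ll_T x :&: ll_normal x)%VS;
  ll_immersion : injective_immersion ll_map;
  ll_rank_gt0 : (0 < ll_rank)%N;
  ll_rad_subbundle : subbundle_of_rank ll_map ll_rank ll_rad;
  ll_screen_subbundle : subbundle ll_map ll_screen;
  ll_screen_nondegenerate : forall x,
    nondegenerate_on (g (ll_map x)) (ll_screen x);
  ll_screen_complement : forall x,
    (ll_rad x + ll_screen x = ll_T x)%VS /\
    (ll_rad x :&: ll_screen x = 0)%VS;
  ll_coscreen_subbundle : subbundle ll_map ll_coscreen;
  ll_coscreen_nondegenerate : forall x,
    nondegenerate_on (g (ll_map x)) (ll_coscreen x);
  ll_coscreen_complement : forall x,
    (ll_rad x + ll_coscreen x = ll_normal x)%VS /\
    (ll_rad x :&: ll_coscreen x = 0)%VS;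
  ll_ltr_subbundle : subbundle_of_rank ll_map ll_rank ll_ltr;
  ll_ltr_spanned : forall x,
    exists (U : set ll_manifold) (E N' : 'I_ll_rank -> ll_manifold -> 'rV[R]_e),
      [/\ open U /\ U x,
          (forall i, smooth_along ll_map U (E i)) /\
          (forall i, smooth_along ll_map U (N' i)),
          forall y, U y ->
            basis_of (ll_rad y) [tuple E i y | i < ll_rank] /\
            basis_of (ll_ltr y) [tuple N' i y | i < ll_rank],
          forall y i, U y ->
            N' i y \in (orth (g (ll_map y)) (ll_screen y) :&:
                        orth (g (ll_map y)) (ll_coscreen y))%VS &
          forall y i j, U y ->
            g (ll_map y) (E i y) (N' j y) = (i == j)%:R /\
            g (ll_map y) (N' i y) (N' j y) = 0]
}.

Section QGCR.
Variables (R : realType) (n : nat) (Mb : nearly_sasakian R n).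
Variable M : lightlike_submanifold (@ns_g R n Mb).

Let f : M -> Mb := @ll_map _ _ _ _ M.
Let phi (x : M) := ns_phi (f x).

(* The sums defining [Dbar] and the screen are not required to be direct:
   phi D2 and phi L may intersect. *)
Record qgcr_decomposition
    (D1 D2 D0 Dbar L S : M -> {vspace 'rV[R]_(2 * n).+1}) : Prop := {
  qgcr_D1 : subbundle f D1;
  qgcr_D2 : subbundle f D2;
  qgcr_rad : forall x, (D1 x + D2 x = ll_rad x)%VS /\ (D1 x :&: D2 x = 0)%VS;
  qgcr_phi_D1 : forall x, (phi x @: D1 x = D1 x)%VS;
  qgcr_phi_D2 : forall x, (phi x @: D2 x <= ll_screen x)%VS;
  qgcr_D0 : subbundle f D0;
  qgcr_Dbar : subbundle f Dbar;
  qgcr_screen : forall x, (phi x @: D2 x + Dbar x + D0 x = ll_screen x)%VS;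
  qgcr_screen_orth : forall x,
    (D0 x <= orth (ns_g (f x)) (phi x @: D2 x + Dbar x))%VS;
  qgcr_D0_nondegenerate : forall x, nondegenerate_on (ns_g (f x)) (D0 x);
  qgcr_phi_D0 : forall x, (phi x @: D0 x <= D0 x)%VS;
  qgcr_L : subbundle f L;
  qgcr_L_sub : forall x, (L x <= ll_ltr x)%VS;
  qgcr_S : subbundle f S;
  qgcr_S_sub : forall x, (S x <= ll_coscreen x)%VS;
  qgcr_Dbar_def : forall x, (Dbar x = phi x @: S x + phi x @: L x)%VS
}.

Definition proper_qgcr : Prop :=
  exists D1 D2 D0 Dbar L S,
    [/\ qgcr_decomposition D1 D2 D0 Dbar L S,
        nonzero_bundle D0, nonzero_bundle D1,
        nonzero_bundle D2 & nonzero_bundle S].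

Definition xi_normal : Prop := forall x : M, ns_xi (f x) \in ll_normal x.

End QGCR.

(* Main.v *)
(* Let p be a point of M and let u be a vector of D_0 at p. Taking Y = xi in
   the nearly Sasakian identity and pairing with u gives
   g(nabla_u xi, phi u) = - g(u, u), because phi xi = 0, eta(u) = 0 and
   nabla_xi phi is skew. Since xi is normal, eta vanishes on TM, so d eta does
   too: g(nabla_u xi, v) = g(nabla_v xi, u) for u, v tangent to M. For
   v = phi u, again in D_0, this reads - g(u, u) = g(phi u, phi u) = g(u, u),
   so g vanishes on D_0, which is therefore both non-degenerate and totally
   null, hence zero. *)

From HB Require Import structures.
Require Import Defs.
From mathcomp Require Import all_boot all_order all_algebra.
From mathcomp Require Import all_classical all_reals all_analysis.
From mathcomp Require Import ring lra.
Import Order.TTheory GRing.Theory Num.Theory.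
Import numFieldNormedType.Exports.

Set Implicit Arguments.
Unset Strict Implicit.
Unset Printing Implicit Defensive.

Local Open Scope classical_set_scope.
Local Open Scope ring_scope.

(** * Differential calculus and the classes [is_Ck] *)

Section Calculus.
Variable R : realType.
Implicit Types U V W : normedModType R.

(** The first-order expansion of [f] at [x] is also one of [g], and such an expansion determines the
    differential. *)
Lemma near_eq_diff_spec V W (f g : V -> W) x : {near x, f =1 g} ->
  differentiable f x -> differentiable g x /\ 'd g x = 'd f x :> (V -> W).
Proof.
move=> fg df.
have gx : g x = f x by rewrite (nbhs_singleton fg).
have [cdf fE] := (diff_locallyP x f).1 df.
have gE : g \o shift x = cst (g x) + 'd f x +o_ 0 id.
  apply/eqaddoP => e e0.
  move/eqaddoP : fE => /(_ e e0) fE; rewrite gx.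
  have fg0 : \forall h \near 0, f (h + x) = g (h + x).
    have : h + x @[h --> (0 : V)] --> 0 + x.
      by apply: cvgD; [exact: cvg_id|exact: cvg_cst].
    by rewrite add0r => /(_ _ fg).
  by near=> h; rewrite !fctE/= -(near fg0 h)//; near: h; exact: fE.
have gf : 'd g x = 'd f x :> (V -> W) by exact: diff_unique.
split; last exact: gf.
by apply: (diff_locallyP x g).2; rewrite gf; exact: (conj cdf gE).
Unshelve. all: by end_near. Qed.

Lemma near_eq_differentiable V W (f h : V -> W) x :
  {near x, f =1 h} -> differentiable f x -> differentiable h x.
Proof. by move=> fh df; have [] := near_eq_diff_spec fh df. Qed.

Lemma near_eq_diff V W (f h : V -> W) x v :
  {near x, f =1 h} -> differentiable f x -> 'd h x v = 'd f x v.
Proof. by move=> fh df; have [_ ->] := near_eq_diff_spec fh df. Qed.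

Lemma diff_comp_at U V W (f : V -> W) (h : U -> V) x v :
  differentiable h x -> differentiable f (h x) ->
  'd (f \o h) x v = 'd f (h x) ('d h x v).
Proof. by move=> dh df; rewrite diff_comp. Qed.

Section Scale.
Variable W : normedModType R.

Let scale_bilinear : bilinear_for
  (GRing.Scale.Law.clone _ _ *:%R _) (GRing.Scale.Law.clone _ _ *:%R _)
  (@GRing.scale R W : R^o -> W -> W).
Proof.
split=> [u'|u] a x y /=.
- by rewrite scalerDl scalerA.
- by rewrite scalerDr !scalerA mulrC.
Qed.

(** Chain rule through scalar multiplication, seen as a continuous bilinear map on [R^o] and [W]. *)
Lemma is_diff_scale V (h : V -> R^o) (f : V -> W) x :
  differentiable h x -> differentiable f x ->
  is_diff x (fun y => h y *: f y)
    (fun v => h x *: 'd f x v + ('d h x v : R) *: f x).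
Proof.
move=> dh df.
pose b := HB.pack_for {bilinear R^o -> W -> W} (@GRing.scale R W : R^o -> W -> W)
  (bilinear_isBilinear.Build R R^o W W _ _ _ scale_bilinear).
have bc : continuous (fun p : R^o * W => b p.1 p.2) by exact: scale_continuous.
have -> : (fun y => h y *: f y) = (fun p => b p.1 p.2) \o (fun y => (h y, f y)).
  by [].
apply: DiffDef.
  apply: differentiable_comp; first exact: differentiable_pair.
  exact: differentiable_bilin.
rewrite diff_comp ?diff_bilin ?diff_pair //.
  exact: differentiable_pair.
exact: differentiable_bilin.
Qed.

End Scale.

Lemma differentiable_scale V W (h : V -> R^o) (f : V -> W) x :
  differentiable h x -> differentiable f x ->
  differentiable (fun y => h y *: f y) x.
Proof. by move=> dh df; case: (is_diff_scale dh df). Qed.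

Lemma derive_scale V W (h : V -> R^o) (f : V -> W) x v :
  differentiable h x -> differentiable f x ->
  'D_v (fun y => h y *: f y) x = h x *: 'D_v f x + ('D_v h x : R) *: f x.
Proof.
move=> dh df; rewrite !deriveE//; last exact: differentiable_scale.
by rewrite (@diff_val _ _ _ _ _ _ _ (is_diff_scale dh df)).
Qed.

Lemma derive_comp U V W (f : V -> W) (g : U -> V) x v :
  differentiable g x -> differentiable f (g x) ->
  'D_v (f \o g) x = 'd f (g x) ('D_v g x).
Proof.
move=> dg df; rewrite !deriveE//; last exact: differentiable_comp.
exact: diff_comp_at.
Qed.

Lemma diff_row_sum n W (f : 'rV[R]_n -> W) x v : differentiable f x ->
  'd f x v = \sum_(j < n) v 0 j *: 'D_('e_j) f x.
Proof.
move=> df; rewrite {1}(row_sum_delta v) linear_sum; apply: eq_bigr => j _.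
by rewrite linearZ deriveE.
Qed.

Lemma differentiable_coord_comp V m (g : V -> 'rV[R]_m) j x :
  differentiable g x -> differentiable (fun y => g y 0 j : R^o) x.
Proof.
move=> dg; apply: (@differentiable_comp _ _ _ _ g (fun M : 'rV[R]_m => M 0 j)) => //.
exact: differentiable_coord.
Qed.

Lemma derive_coord V m (g : V -> 'rV[R]_m) j x v :
  differentiable g x -> 'D_v (fun y => g y 0 j : R^o) x = 'D_v g x 0 j.
Proof. by move=> dg; rewrite derive_mx ?mxE//; exact: diff_derivable. Qed.

Lemma is_CkS k V W (O : set V) (f : V -> W) : is_Ck k.+1 O f -> is_Ck k O f.
Proof.
elim: k f => [|k IH] f [df Df].
  by move=> x Ox; exact: differentiable_continuous (df x Ox).
by split=> // v; exact: IH (Df v).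
Qed.

Lemma is_Ck_sub k V W (O O' : set V) (f : V -> W) :
  O' `<=` O -> is_Ck k O f -> is_Ck k O' f.
Proof.
move=> sub; elim: k f => [|k IH] f /=; first by move=> cf x /sub; exact: cf.
by case=> df Df; split=> [x /sub|v]; [exact: df|exact: IH].
Qed.

Lemma near_eq_in V W (O : set V) (f g : V -> W) x :
  open O -> O x -> (forall y, O y -> f y = g y) -> {near x, f =1 g}.
Proof. by move=> oO Ox fg; apply: filterS (open_nbhs_nbhs (conj oO Ox)). Qed.

(** Agreement on an open set is agreement near each of its points, so the derivatives agree there
    too and the induction goes on. *)
Lemma is_Ck_ext k V W (O : set V) (f g : V -> W) : open O ->
  (forall x, O x -> f x = g x) -> is_Ck k O f -> is_Ck k O g.
Proof.
move=> oO; elim: k f g => [|k IH] f g fg /=.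
  move=> cf x Ox; have cfx : f @ x --> f x := cf x Ox.
  suff : g @ x --> g x by [].
  rewrite -(fg x Ox); apply: cvg_trans cfx.
  by apply: near_eq_cvg; exact: (near_eq_in oO Ox fg).
case=> df Df; split=> [x Ox|v].
  exact: near_eq_differentiable (near_eq_in oO Ox fg) (df x Ox).
apply: IH (Df v) => x Ox; apply: near_eq_derive.
exact: (near_eq_in oO Ox fg).
Qed.

Lemma is_Ck_cst k V W (O : set V) (a : W) : is_Ck k O (fun=> a).
Proof.
elim: k a => [|k IH] a /=; first by move=> x _; exact: cst_continuous.
split=> [x _|v]; first exact: differentiable_cst.
have -> : (fun x => 'D_v (fun=> a) x) = (fun=> 0 : W).
  by apply/funext => x; exact: derive_cst.
exact: IH.
Qed.

Lemma is_CkD k V W (O : set V) (f g : V -> W) : open O ->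
  is_Ck k O f -> is_Ck k O g -> is_Ck k O (fun x => f x + g x).
Proof.
move=> oO; elim: k f g => [|k IH] f g /=.
  by move=> cf cg x Ox; apply: cvgD; [exact: cf|exact: cg].
case=> df Df [dg Dg]; split=> [x Ox|v].
  by apply: differentiableD; [exact: df|exact: dg].
apply: is_Ck_ext (IH _ _ (Df v) (Dg v)) => // x Ox.
by rewrite deriveD//; apply: diff_derivable; [exact: df|exact: dg].
Qed.

Lemma is_Ck_sum k V W (O : set V) n (F : 'I_n -> V -> W) : open O ->
  (forall i, is_Ck k O (F i)) -> is_Ck k O (fun x => \sum_(i < n) F i x).
Proof.
move=> oO; elim: n F => [|n IH] F CF.
  apply: is_Ck_ext (is_Ck_cst k O (0 : W)) => // x _.
  by rewrite big_ord0.
apply: is_Ck_ext (is_CkD oO (IH _ (fun i => CF (widen_ord (leqnSn n) i)))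
  (CF ord_max)) => // x _.
by rewrite big_ord_recr.
Qed.

(** Leibniz rule; [is_CkS] lowers the order of the factor left undifferentiated so that the
    induction hypothesis applies. *)
Lemma is_Ck_scale k V W (O : set V) (h : V -> R^o) (f : V -> W) : open O ->
  is_Ck k O h -> is_Ck k O f -> is_Ck k O (fun x => h x *: f x).
Proof.
move=> oO; elim: k h f => [|k IH] h f.
  by move=> ch cf x Ox; apply: cvgZ; [exact: ch|exact: cf].
move=> Ch Cf; move: (Ch) (Cf) => [dh Dh] [df Df]; split=> [x Ox|v].
  by apply: differentiable_scale; [exact: dh|exact: df].
apply: is_Ck_ext (is_CkD oO (IH _ _ (is_CkS Ch) (Df v))
  (IH _ _ (Dh v) (is_CkS Cf))) => // x Ox.
by rewrite derive_scale//; [exact: dh|exact: df].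
Qed.

Lemma is_Ck_coord k V m (O : set V) (g : V -> 'rV[R]_m) j : open O ->
  is_Ck k O g -> is_Ck k O (fun x => g x 0 j : R^o).
Proof.
move=> oO; elim: k g => [|k IH] g.
  move=> cg x Ox; apply: (@continuous_comp _ _ _ g (fun M : 'rV[R]_m => M 0 j)).
    exact: cg.
  exact: coord_continuous.
case=> dg Dg; split=> [x Ox|v].
  by apply: differentiable_coord_comp; exact: dg.
apply: is_Ck_ext (IH _ (Dg v)) => // x Ox.
by rewrite derive_coord//; exact: dg.
Qed.

(** By the chain rule, the derivative along [v] is a finite sum over the coordinates [j] of the
    middle space: component [j] of ['D_v g] times ['D_('e_j) f] composed with [g]. The induction
    hypothesis covers the second factor. *)
Lemma is_Ck_comp k V W m (O : set V) (O' : set 'rV[R]_m)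
    (f : 'rV[R]_m -> W) (g : V -> 'rV[R]_m) :
  open O -> (forall x, O x -> O' (g x)) ->
  is_Ck k O' f -> is_Ck k O g -> is_Ck k O (f \o g).
Proof.
move=> oO gO; elim: k f g gO => [|k IH] f g gO.
  move=> cf cg x Ox; apply: continuous_comp; first exact: cg.
  exact: cf (gO _ Ox).
move=> [df Df] Cg; move: (Cg) => [dg Dg]; split=> [x Ox|v].
  by apply: differentiable_comp; [exact: dg|exact: df (gO _ Ox)].
apply: is_Ck_ext (is_Ck_sum oO (fun j => is_Ck_scale oO
  (is_Ck_coord j oO (Dg v)) (IH _ _ gO (Df 'e_j) (is_CkS Cg)))) => // x Ox.
have dfx := df _ (gO _ Ox).
by rewrite (derive_comp v (dg _ Ox) dfx) (diff_row_sum _ dfx).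
Qed.

Lemma is_derive_line V W (f : V -> W) (y a : V) (t : R) :
  differentiable f (t *: a + y) ->
  is_derive t (1 : R) (fun s : R => f (s *: a + y)) ('D_a f (t *: a + y)).
Proof.
move=> dft; have df : derivable f (t *: a + y) a by exact: diff_derivable.
have E : (fun h : R => h^-1 *: (((fun s : R => f (s *: a + y)) \o shift t)
    (h *: (1 : R)) - f (t *: a + y))) =
  (fun h : R => h^-1 *: ((f \o shift (t *: a + y)) (h *: a) - f (t *: a + y))).
  by apply/funext => h /=; rewrite /= scalerDl addrA -[h *: 1]/(h * 1) mulr1.
by apply: DeriveDef; [rewrite /derivable E|rewrite /derive E].
Qed.

Lemma smooth_differentiable V W (O : set V) (g : V -> W) x :
  smooth_on O g -> O x -> differentiable g x.
Proof. by move=> /(_ 1%N)[dg _] /dg. Qed.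

End Calculus.

(** * Symmetry of mixed second derivatives *)

Section Schwarz.
Variables (R : realType) (V : normedModType R).

(** Triangle inequality through [D], divided by [k]. In [derive_sym], [D] is a second difference and
    [k] the square of its step. *)
Lemma dist_le_of_scaled (D A B k e : R) : 0 < k ->
  `|D - k * A| <= e * k -> `|D - k * B| <= e * k -> `|A - B| <= 2 * e.
Proof.
move=> k0 HA HB; rewrite -(ler_pM2l k0) -{1}(gtr0_norm k0) -normrM.
have -> : k * (A - B) = (D - k * B) - (D - k * A) by ring.
by apply: (le_trans (ler_normB _ _)); lra.
Qed.

(** The second difference over the parallelogram on [s *: a] and [s *: b] is unchanged when [a] and
    [b] are exchanged; this estimate, used in both orders, yields [derive_sym]. *)
Lemma second_difference (f : V -> R^o) (x a b : V) (e : R) :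
  (\forall y \near x, differentiable f y) ->
  differentiable (fun y => 'D_a f y : R^o) x -> 0 < e ->
  \forall s \near (0 : R)^'+,
    `|f (s *: a + (s *: b + x)) - f (s *: b + x) - (f (s *: a + x) - f x)
      - s ^+ 2 * 'D_b (fun y => 'D_a f y : R^o) x| <= e * s ^+ 2.
Proof.
move=> df dg e0; pose g : V -> R^o := fun y => 'D_a f y.
(* For [0 < c < s], the two errors are taken at [c *: a + s *: b] and [c *: a], whose norms add up
   to at most [s * (2 * |a| + |b|)]; the extra 1 keeps [C] positive. *)
pose C := 2 * `|a| + `|b| + 1.
have C0 : 0 < C by rewrite /C; have := normr_ge0 a; have := normr_ge0 b; lra.
have [_ /eqaddoP gE] := (diff_locallyP x g).1 dg.
have /nbhs_ballP[/= r1 r10 r1P] := gE _ (divr_gt0 e0 C0).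
have /nbhs_ballP[/= r2 r20 r2P] := df.
have gP h : `|h| < r1 -> `|g (h + x) - (g x + 'd g x h)| <= e / C * `|h|.
  by move=> hr; apply: (r1P h); rewrite -ball_normE /ball_/= sub0r normrN.
have fP h : `|h| < r2 -> differentiable f (h + x).
  move=> hr; apply: r2P; rewrite /= -ball_normE /ball_/=.
  by rewrite opprD addrCA subrr addr0 normrN.
near=> s.
have s0 : 0 < s by [].
have sC1 : s * C < r1.
  by rewrite -ltr_pdivlMr//; near: s; apply: nbhs_right_lt; rewrite divr_gt0.
have sC2 : s * C < r2.
  by rewrite -ltr_pdivlMr//; near: s; apply: nbhs_right_lt; rewrite divr_gt0.
pose psi t := f (t *: a + (s *: b + x)) - f (t *: a + x).
have small t u : `|t| <= s -> `|u| <= s -> `|t *: a + u *: b| <= s * C - s * `|a| - s.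
  move=> ts us; apply: (le_trans (ler_normD _ _)); rewrite !normrZ /C.
  have := ler_wpM2r (normr_ge0 a) ts; have := ler_wpM2r (normr_ge0 b) us; lra.
have sa0 : 0 <= s * `|a| by rewrite mulr_ge0// ltW.
have dpsi t : `|t| <= s -> is_derive t (1 : R) psi
    (g (t *: a + (s *: b + x)) - g (t *: a + x)).
  move=> ts; apply: is_deriveB; apply: is_derive_line.
    rewrite addrA; apply: fP; apply: le_lt_trans (small _ _ ts _) _.
      by rewrite ger0_norm// ltW.
    lra.
  rewrite -[t *: a]addr0 -(scale0r b); apply: fP; apply: le_lt_trans (small _ _ ts _) _.
    by rewrite normr0 ltW.
  lra.
(* The mean value theorem along [a], then the differential of ['D_a f] at [x]
   along [b], each contribute one factor [s]. *)
have [c /[!in_itv]/= /andP[c0 cs] psiE] : exists2 c, c \in `]0, s[%R &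
    psi s - psi 0 = (g (c *: a + (s *: b + x)) - g (c *: a + x)) * (s - 0).
  apply: MVT => //.
    move=> t /[!in_itv]/= /andP[t0 ts]; apply: dpsi.
    by rewrite ger0_norm ?(ltW t0)// ltW.
  apply: continuous_in_subspaceT => t /[!inE]/= /[!in_itv]/= /andP[t0 ts].
  have /dpsi H : `|t| <= s by rewrite ger0_norm.
  apply: differentiable_continuous; apply/derivable1_diffP; exact: ex_derive.
have -> : f (s *: a + (s *: b + x)) - f (s *: b + x) - (f (s *: a + x) - f x)
    = psi s - psi 0.
  rewrite /psi !scale0r !add0r; ring.
rewrite psiE subr0 [c *: a + (s *: b + x)]addrA deriveE//.
have cs' : `|c| <= s by rewrite ger0_norm ?(ltW c0)// ltW.
have ss' : `|s| <= s by rewrite ger0_norm// ltW.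
have h1 := small _ _ cs' ss'.
have h2 : `|c *: a| <= s * C - s * `|a| - s.
  by rewrite -[c *: a]addr0 -(scale0r b); apply: small => //; rewrite normr0 ltW.
have h1' : `|c *: a + s *: b| < r1 by apply: (le_lt_trans h1); lra.
have h2' : `|c *: a| < r1 by apply: (le_lt_trans h2); lra.
have k1 := gP _ h1'; have k2 := gP _ h2'.
have ga : 'd g x (c *: a) = c * 'd g x a :> R by rewrite linearZ.
have gab : 'd g x (c *: a + s *: b) = c * 'd g x a + s * 'd g x b :> R.
  by rewrite linearD !linearZ.
rewrite gab in k1; rewrite ga in k2; move: k1 k2.
set B : R := g (_ + _ + _); set A : R := g (_ + _); set G : R := g x.
set da : R := 'd g x a; set db : R := 'd g x b => k1 k2.
(* The two expansions share [G + c * da], which cancels in [B - A] and leaves [s * db] plus the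
   errors. *)
have -> : (B - A) * s - s ^+ 2 * db =
   s * ((B - (G + (c * da + s * db))) - (A - (G + c * da))) by ring.
rewrite normrM gtr0_norm// expr2 mulrCA ler_pM2l//.
apply: (le_trans (ler_normB _ _)).
apply: (le_trans (lerD k1 k2)); rewrite -mulrDr -mulrA.
rewrite ler_pM2l// mulrC ler_pdivrMr//.
apply: (le_trans (lerD (ler_normD _ _) (lexx _))); rewrite !normrZ.
have := ler_wpM2r (normr_ge0 a) cs'; have := ler_wpM2r (normr_ge0 b) ss'.
rewrite /C; lra.
Unshelve. all: by end_near. Qed.

Lemma derive_sym (f : V -> R^o) (x a b : V) :
  (\forall y \near x, differentiable f y) ->
  differentiable (fun y => 'D_a f y : R^o) x ->
  differentiable (fun y => 'D_b f y : R^o) x ->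
  'D_b (fun y => 'D_a f y : R^o) x = 'D_a (fun y => 'D_b f y : R^o) x.
Proof.
move=> df da db.
set A : R^o := 'D_b _ x; set B : R^o := 'D_a _ x.
apply: contrapT => /eqP AB.
have D0 : 0 < `|A - B| by rewrite normr_gt0 subr_eq0.
(* [dist_le_of_scaled] doubles the error, so a third of the distance gives
   [|A - B| <= 2/3 * |A - B|]. *)
have e0 : 0 < `|A - B| / 3 by rewrite divr_gt0.
have Na := second_difference b df da e0.
have Nb := second_difference a df db e0.
have [s [/= s0 [/= Ha Hb]]] := @filter_ex _ (0 : R)^'+ _ _
  (filterI (nbhs_right_gt 0) (filterI Na Nb)).
have DE : f (s *: b + (s *: a + x)) - f (s *: a + x) - (f (s *: b + x) - f x) =
    f (s *: a + (s *: b + x)) - f (s *: b + x) - (f (s *: a + x) - f x).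
  by rewrite [s *: b + (s *: a + x)]addrCA !opprB addrACA [RHS]addrACA [- _ - _]addrC.
rewrite DE in Hb; have := dist_le_of_scaled (exprn_gt0 2 s0) Ha Hb.
move=> H; suff : `|A - B| < `|A - B| by rewrite ltxx.
apply: (le_lt_trans H); rewrite mulrCA gtr_pMr// ltr_pdivrMr// mul1r ltr_nat//.
Qed.

End Schwarz.

(** * Forms with vanishing pullback, in coordinates *)

Section Pullback.
Variable R : realType.

(** The 1-form with coefficients [al k] pulls back to zero under [F]. Differentiating this along a
    second vector leaves, besides a term of the claim, one in the second derivatives of [F], which
    is symmetric. *)
Lemma pullback_closed m e (F : 'rV[R]_m -> 'rV[R]_e) (al : 'I_e -> 'rV[R]_e -> R^o)
    (O : set 'rV[R]_m) z a b : open O -> O z -> is_Ck 2 O F ->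
  (forall k, differentiable (al k) (F z)) ->
  (forall y c, O y -> \sum_(k < e) ('D_c F y 0 k : R) *: al k (F y) = 0) ->
  \sum_(k < e) ('D_a F z 0 k : R) *: 'd (al k) (F z) ('D_b F z) =
  \sum_(k < e) ('D_b F z 0 k : R) *: 'd (al k) (F z) ('D_a F z).
Proof.
move=> oO Oz [dF DF] dal F0.
have dFz c : differentiable (fun y => 'D_c F y) z by exact: (DF c).1.
have key c c' : \sum_(k < e) ('D_c F z 0 k : R) *: 'd (al k) (F z) ('D_c' F z) =
    - \sum_(k < e) ('D_c' (fun y => 'D_c F y) z 0 k : R) *: al k (F z).
  apply/eqP; rewrite -addr_eq0 -big_split/=; apply/eqP.
  have dalF k : differentiable (al k \o F) z.
    by apply: differentiable_comp; [exact: dF|exact: dal].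
  have dco k : differentiable (fun y => 'D_c F y 0 k : R^o) z.
    exact: differentiable_coord_comp.
  transitivity ('D_c' (\sum_(k < e) (fun y => ('D_c F y 0 k : R) *: (al k \o F) y)) z).
    rewrite derive_sum; last first.
      by move=> k; apply: diff_derivable; exact: differentiable_scale.
    apply: eq_bigr => k _; rewrite derive_scale//.
    by rewrite (derive_comp c' (dF z Oz) (dal k)) (derive_coord k c' (dFz c)).
  rewrite (@near_eq_derive _ _ _ _ (fun=> 0)) ?derive_cst//.
  apply: (near_eq_in oO Oz) => y Oy; rewrite -[RHS](F0 y c Oy).
  by rewrite fct_sumE.
(* By [key], only the symmetry of the mixed derivatives of each component of [F] remains; the
   component is moved inside both derivatives to reach the scalar [derive_sym]. *)
apply: etrans (key a b) (etrans _ (esym (key b a))).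
apply: (congr1 (@GRing.opp R^o)); apply: eq_bigr => k _.
apply: (congr1 (fun c : R => c *: al k (F z))).
apply: etrans (esym (derive_coord k b (dFz a))) (etrans _ (derive_coord k a (dFz b))).
have nO := open_nbhs_nbhs (conj oO Oz).
have E c : {near z, (fun y => 'D_c F y 0 k : R^o) =1 'D_c (fun y => F y 0 k : R^o)}.
  by apply: filterS nO => y Oy; rewrite derive_coord//; exact: dF.
apply: etrans (near_eq_derive b (E a)) (etrans _ (esym (near_eq_derive a (E b)))).
apply: derive_sym.
- by apply: filterS nO => y Oy; apply: differentiable_coord_comp; exact: dF.
- exact: near_eq_differentiable (E a) (differentiable_coord_comp k (dFz a)).
- exact: near_eq_differentiable (E b) (differentiable_coord_comp k (dFz b)).
Qed.

End Pullback.

(** * Chart transitions and coordinate fields *)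

Section Charts.
Variables (R : realType) (d : nat) (M : manifold R d).

(** Inside the open image of the chart, this set is the preimage of [U] under [minv i], which is
    continuous there. *)
Lemma open_chart_image (i : mindex M) (U : set M) : open U ->
  open (mchart i @` (mdom i `&` U)).
Proof.
move=> oU; rewrite openE => _ [p [ip Up] <-].
have Ox : (mchart i @` mdom i) (mchart i p) by exists p.
have c := @minv_continuous _ _ M i _ Ox.
have nU : nbhs (mchart i p) (minv i @^-1` U).
  by apply: c; rewrite mchartK//; exact: open_nbhs_nbhs.
have nD := open_nbhs_nbhs (conj (@mimage_open _ _ M i) Ox).
apply: (filterS _ (filterI nU nD)) => y [/= + [q iq qy]].
by rewrite -qy mchartK// => Uq; exists q.
Qed.

Definition transition (i j : mindex M) := mchart j \o minv i.

Lemma differentiable_transition i j p : mdom i p -> mdom j p ->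
  differentiable (transition i j) (mchart i p).
Proof.
by move=> ip jp; apply: (smooth_differentiable (mtransition_smooth i j)); exists p.
Qed.

(** Chain rule: the transitions compose near [mchart i p]. Reading a tangent vector is thus
    independent of the intermediate chart. *)
Lemma diff_transition_comp i j k p v : mdom i p -> mdom j p -> mdom k p ->
  'd (transition j k) (mchart j p) ('d (transition i j) (mchart i p) v) =
  'd (transition i k) (mchart i p) v.
Proof.
move=> ip jp kp.
have E : mchart j p = transition i j (mchart i p) by rewrite /transition/= mchartK.
have dij := differentiable_transition ip jp.
have djk := differentiable_transition jp kp.
have dik := differentiable_transition ip kp.
rewrite E in djk *.
apply: etrans (esym (diff_comp_at v dij djk)) _.
apply: near_eq_diff dik.
apply: (near_eq_in (@open_chart_image i _ (@mdom_open _ _ M j))).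
  by exists p.
by move=> _ [q [iq jq] <-]; rewrite /transition/= [minv i _]mchartK// mchartK.
Qed.

Lemma diff_transition_id i p v : mdom i p ->
  'd (transition i i) (mchart i p) v = v.
Proof.
move=> ip.
rewrite (@near_eq_diff _ _ _ id).
- by rewrite diff_val.
- apply: (near_eq_in (@mimage_open _ _ M i)); first by exists p.
  by move=> _ [q iq <-]; rewrite /transition/= mchartK.
- exact: ex_diff.
Qed.

(* The field with constant components [w] in the chart [j]; meaningful only on
   [mdom j]. *)
Definition coord_vf (j : mindex M) (w : 'rV[R]_d) (q : M) : 'rV[R]_d :=
  'd (transition j (chart_at q)) (mchart j q) w.

Lemma coord_vf_at p w : coord_vf (chart_at p) w p = w.
Proof. by rewrite /coord_vf diff_transition_id//; exact: chart_at_dom. Qed.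

Lemma tread_coord_vf i j w q : mdom i q -> mdom j q ->
  tread i q (coord_vf j w q) = 'd (transition j i) (mchart j q) w.
Proof. by move=> iq jq; apply: diff_transition_comp => //; exact: chart_at_dom. Qed.

(** In a chart [i] the field reads as ['D_w (transition j i)] composed with [transition i j], at the
    cost of one order of differentiability. *)
Lemma smooth_coord_vf j w : smooth_vf (mdom j) (coord_vf j w).
Proof.
move=> i; have oO := @open_chart_image i _ (@mdom_open _ _ M j).
move=> k.
pose g := fun y => 'D_w (transition j i) y.
apply: (@is_Ck_ext _ k _ _ _ (g \o transition i j)) => //.
  move=> _ [q [iq jq] <-].
  rewrite /vf_coord mchartK// tread_coord_vf// /g /= {2}/transition/= mchartK//.
  by rewrite deriveE//; exact: differentiable_transition.
apply: (is_Ck_comp (O' := mchart j @` (mdom j `&` mdom i)) oO).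
- move=> _ [q [iq jq] <-]; exists q; last by rewrite /transition/= mchartK.
  by split; [exact: jq|exact: iq].
- exact: (mtransition_smooth j i k.+1).2.
- exact: mtransition_smooth.
Qed.

(** In [chart_at p] both fields have constant components, so both differentials in the bracket
    vanish. *)
Lemma lie_bracket_coord_vf p u v :
  lie_bracket (coord_vf (chart_at p) u) (coord_vf (chart_at p) v) p = 0.
Proof.
have cp := chart_at_dom p.
suff E w a : 'd (vf_coord (chart_at p) (coord_vf (chart_at p) w))
    (mchart (chart_at p) p) a = 0.
  exact: etrans (congr2 (fun a b => a - b) (E v _) (E u _)) (subrr 0).
rewrite (@near_eq_diff _ _ _ (cst w)).
- by rewrite diff_cst.
- apply: (near_eq_in (@mimage_open _ _ M (chart_at p))); first by exists p.
  move=> _ [q iq <-].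
  by rewrite /vf_coord mchartK// tread_coord_vf// diff_transition_id.
- exact: differentiable_cst.
Qed.

End Charts.

(** * Forms annihilating the tangent spaces of a submanifold *)

Section Immersion.
Variables (R : realType) (d e : nat) (M : manifold R d) (N : manifold R e).
Variables (f : M -> N) (f_smooth : smooth_map f).

Definition local_rep (i : mindex M) (j : mindex N) := mchart j \o f \o minv i.

Lemma open_local_rep i j : open (mchart i @` (mdom i `&` f @^-1` mdom j)).
Proof.
apply: open_chart_image; case: f_smooth => cf _.
by move/continuousP: cf; apply; exact: mdom_open.
Qed.

Arguments open_local_rep : clear implicits.

Lemma differentiable_local_rep i j q : mdom i q -> mdom j (f q) ->
  differentiable (local_rep i j) (mchart i q).
Proof.
move=> iq jq; case: f_smooth => _ sf.
by apply: (smooth_differentiable (sf i j)); exists q.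
Qed.

Lemma local_repE i j q : mdom i q -> local_rep i j (mchart i q) = mchart j (f q).
Proof. by move=> iq; rewrite /local_rep/= mchartK. Qed.

(** Both sides differentiate [f] read from [i] to [j'], factored through [j] or through [i']; the
    factorizations agree near [mchart i q]. *)
Lemma diff_local_rep_transition i i' j j' q v :
  mdom i q -> mdom i' q -> mdom j (f q) -> mdom j' (f q) ->
  'd (transition j j') (mchart j (f q)) ('d (local_rep i j) (mchart i q) v) =
  'd (local_rep i' j') (mchart i' q) ('d (transition i i') (mchart i q) v).
Proof.
move=> iq i'q jq j'q.
have dF := differentiable_local_rep iq jq.
have dF' := differentiable_local_rep i'q j'q.
have dt := differentiable_transition iq i'q.
have ds := differentiable_transition jq j'q.
have Ei : mchart i' q = transition i i' (mchart i q).
  by rewrite /transition/= mchartK.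
rewrite Ei in dF' *; rewrite -(local_repE j iq) in ds *.
apply: etrans (esym (diff_comp_at v dF ds)) (etrans _ (diff_comp_at v dt dF')).
apply: near_eq_diff; last exact: differentiable_comp.
have o1 : open (mchart i @` (mdom i `&` mdom i')).
  exact: open_chart_image (@mdom_open _ _ M i').
apply: (near_eq_in (openI (open_local_rep i j) o1)).
  by split; exists q.
move=> _ [[r [ir jr] <-] [r' [ir' i'r'] rr']].
have {}rr' : r' = r by rewrite -(mchartK ir') rr' mchartK.
rewrite rr' in i'r'.
by rewrite /transition /local_rep/= [minv i _]mchartK// !mchartK.
Qed.

(** [dmap] is taken in the charts chosen by [chart_at]; the previous lemma carries the vector there
    from [i] and [j]. *)
Lemma coord_vf_tangent i j q a : mdom i q -> mdom j (f q) ->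
  coord_vf j ('d (local_rep i j) (mchart i q) a) (f q) \in tangent_image f q.
Proof.
move=> iq jq; rewrite /coord_vf.
rewrite (diff_local_rep_transition a iq (chart_at_dom q) jq (chart_at_dom (f q))).
have -> : 'd (local_rep (chart_at q) (chart_at (f q))) (mchart (chart_at q) q)
    ('d (transition i (chart_at q)) (mchart i q) a) =
    dmap f q ('d (transition i (chart_at q)) (mchart i q) a) by rewrite lfunE.
exact: memv_img (memvf _).
Qed.

(* [f] pulls [eta] back to [0], hence also [d eta]; evaluated on commuting
   coordinate fields, [d eta] is the difference of the two sides. *)
Lemma annihilating_form_closed (eta : N -> 'Hom('rV[R]_e, R^o)) x u v :
  (forall U X, open U -> smooth_vf U X -> smooth_fun U (fun p => eta p (X p))) ->
  (forall q w, w \in tangent_image f q -> eta (f q) w = 0) ->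
  u \in tangent_image f x -> v \in tangent_image f x ->
  dfun (fun p => eta p (coord_vf (chart_at (f x)) v p)) (f x) u =
  dfun (fun p => eta p (coord_vf (chart_at (f x)) u p)) (f x) v.
Proof.
move=> eta_smooth eta0 /memv_imgP[a _ ->] /memv_imgP[b _ ->].
rewrite !lfunE/=.
set j := chart_at (f x); set i := chart_at x.
pose F := local_rep i j; pose z := mchart i x.
(* The coefficients of [eta] in the chart [j], as functions of the coordinates. *)
pose al k := (fun p => eta p (coord_vf j 'e_k p)) \o minv j.
have ix : mdom i x by exact: chart_at_dom.
have jx : mdom j (f x) by exact: chart_at_dom.
have etaE w q : eta q (coord_vf j w q) =
    \sum_(k < e) w 0 k *: eta q (coord_vf j 'e_k q).
  rewrite {1}/coord_vf {1}(row_sum_delta w) !linear_sum; apply: eq_bigr => k _.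
  by rewrite !linearZ.
have dal k : differentiable (al k) (mchart j (f x)).
  apply: (smooth_differentiable (eta_smooth _ _ (@mdom_open _ _ N j)
    (@smooth_coord_vf _ _ N j 'e_k) j)).
  by exists (f x).
(* The components [w] are constant, so only the coefficients of [eta] get differentiated. *)
have dfunE w c : dfun (fun p => eta p (coord_vf j w p)) (f x) c =
    \sum_(k < e) w 0 k *: 'd (al k) (mchart j (f x)) c.
  have dZ k : differentiable (fun y => w 0 k *: al k y) (mchart j (f x)).
    exact: differentiableZ.
  rewrite /dfun -/j.
  have -> : (fun p => eta p (coord_vf j w p)) \o minv j =
      \sum_(k < e) (fun y => w 0 k *: al k y).
    by apply/funext => y; rewrite fct_sumE/= etaE.
  rewrite -deriveE; last exact: differentiable_sum.
  rewrite derive_sum; last by move=> k; exact: diff_derivable.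
  apply: eq_bigr => k _; rewrite deriveZ; last exact: diff_derivable.
  by rewrite deriveE.
rewrite !dfunE -/(local_rep i j) -/F -/z.
have dF : differentiable F z by exact: differentiable_local_rep.
have Fz : F z = mchart j (f x) by exact: local_repE.
rewrite -Fz in dal *.
rewrite -(deriveE a dF) -(deriveE b dF).
apply/esym; apply: (pullback_closed (O := mchart i @` (mdom i `&` f @^-1` mdom j))) => //.
- exact: open_local_rep.
- by exists x.
- by case: f_smooth => _ /(_ i j 2%N).
(* The sum is [eta] evaluated on the image of [c] under the differential of [f], a tangent vector of
   the submanifold. *)
- move=> _ c [q [iq jq] <-].
  have dFq := differentiable_local_rep iq jq.
  rewrite deriveE// /F (local_repE j iq) /al/= mchartK//.
  by rewrite -etaE; apply: eta0; exact: coord_vf_tangent.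
Qed.

End Immersion.

(** * Identities on a nearly Sasakian manifold *)

Section NearlySasakian.
Variables (R : realType) (n : nat) (Mb : nearly_sasakian R n).
Implicit Types (p : Mb) (u v w : 'rV[R]_(2 * n).+1).

Local Notation g := (@ns_g R n Mb).
Local Notation phi := (@ns_phi R n Mb).
Local Notation eta := (@ns_eta R n Mb).
Local Notation xi := (@ns_xi R n Mb).
Local Notation nabla := (@ns_nabla R n Mb).

Lemma ns_g_sym p u v : g p u v = g p v u.
Proof. exact: (Defs.metric_sym (ns_metric Mb)). Qed.

Lemma ns_eta_g p u : g p (xi p) u = eta p u.
Proof.
have := ns_compatible p (xi p) u.
rewrite ns_phi_xi linear0 zero_lfunE ns_eta_xi mul1r => /esym/eqP.
by rewrite subr_eq0 => /eqP.
Qed.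

(** Compatibility for [u] and [phi v], since [eta] kills the image of [phi] and is dual to [xi]. *)
Lemma ns_g_phi p u v : g p (phi p u) v = - g p u (phi p v).
Proof.
have := ns_compatible p u (phi p v).
rewrite ns_eta_phi mulr0 subr0 ns_phi2 linearD linearN linearZ/=.
rewrite [ns_g _ _ (ns_xi p)]ns_g_sym ns_eta_g ns_eta_phi scaler0 addr0 => <-.
by rewrite opprK.
Qed.

Lemma ns_g_phi_self p u : g p (phi p u) u = 0.
Proof.
have /eqP := ns_g_phi p u u; rewrite [g p u _]ns_g_sym -addr_eq0 -mulr2n.
by rewrite mulrn_eq0/= => /eqP.
Qed.

Local Notation E p w := (coord_vf (chart_at p) w : Mb -> _).

Let smoothE p w : smooth_vf (mdom (chart_at p)) (E p w).
Proof. exact: smooth_coord_vf. Qed.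

Let openE p : open (mdom (chart_at p) : set Mb).
Proof. exact: mdom_open. Qed.

Let domE p : mdom (chart_at p) p.
Proof. exact: chart_at_dom. Qed.

Let smooth_xi (U : set Mb) : smooth_vf U xi.
Proof.
move=> i k; apply: is_Ck_sub (@ns_xi_smooth _ _ Mb i k).
by move=> _ [q [iq _] <-]; exists q.
Qed.

(** The differentiated field is zero, hence its own double, and additivity makes its derivative
    equal to its own double as well. *)
Lemma nabla_phi_xi p u : nabla p u (fun q => phi q (xi q)) = 0.
Proof.
have C := ns_levi_civita Mb.
have s0 : smooth_vf (setT : set Mb) (fun q => phi q (xi q)).
  by apply: ns_phi_smooth; [exact: openT|exact: ns_xi_smooth].
have H := nabla_add C u openT (I : setT p) s0 s0.
have : nabla p u (fun q => phi q (xi q) + phi q (xi q)) =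
    nabla p u (fun q => phi q (xi q)).
  congr (nabla p u _); apply/funext => q; rewrite ns_phi_xi addr0 //.
move=> /(etrans (esym H))/eqP; rewrite -subr_eq0 addrK => /eqP; exact.
Qed.

(** Extend [u] by a coordinate field [Y] and differentiate [g (phi Y) Y = 0] along [w]; [ns_g_phi]
    moves [phi] across the metric. *)
Lemma nabla_endo_skew p w u :
  g p (nabla_endo nabla phi p w (E p u)) u = 0.
Proof.
have C := ns_levi_civita Mb.
have s1 := ns_phi_smooth (openE p) (smoothE p u).
have := nabla_metric C w (openE p) (domE p) s1 (smoothE p u).
have -> : (fun q => ns_g q (ns_phi q (E p u q)) (E p u q)) = cst 0 :> (_ -> R^o).
  by apply/funext => q; exact: ns_g_phi_self.
rewrite /dfun /= diff_cst /nabla_endo coord_vf_at => H.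
rewrite linearB/= add_lfunE opp_lfunE ns_g_phi opprK.
by rewrite [X in _ + X]ns_g_sym; exact: esym H.
Qed.

Lemma g_nabla_xi_phi p u : eta p u = 0 ->
  g p (nabla p u xi) (phi p u) = - g p u u.
Proof.
move=> eu.
have := ns_nearly (openE p) (domE p) (smoothE p u) (smooth_xi _).
rewrite {1}/nabla_endo nabla_phi_xi sub0r.
rewrite coord_vf_at ns_g_sym ns_eta_g eu ns_eta_xi.
rewrite mulr0 !scale0r sub0r subr0 scale1r.
(* At this point the identity reads: minus [phi] of the derivative of [xi] along [u], plus the
   derivative of [phi] along [xi] at [u], equals [- u]. *)
move=> /(congr1 (fun y => g p y u)).
rewrite linearD add_lfunE nabla_endo_skew addr0 !linearN /= !opp_lfunE ns_g_phi.
by rewrite opprK.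
Qed.

(** The left side is the exterior derivative of [eta] on commuting fields. Since [eta] is [g xi],
    metric compatibility produces the right side plus two terms that cancel by vanishing torsion. *)
Lemma d_eta p u v :
  dfun (fun q => eta q (E p v q)) p u - dfun (fun q => eta q (E p u q)) p v =
  g p (nabla p u xi) v - g p (nabla p v xi) u.
Proof.
have C := ns_levi_civita Mb.
have m w := nabla_metric C _ (openE p) (domE p) (smooth_xi _) (smoothE p w).
have eE w : (fun q => eta q (E p w q)) = (fun q => g q (xi q) (E p w q)).
  by apply/funext => q; rewrite ns_eta_g.
rewrite !eE !m.
have := nabla_torsion_free C (openE p) (domE p) (smoothE p u) (smoothE p v).
rewrite lie_bracket_coord_vf !coord_vf_at => /eqP; rewrite subr_eq0 => /eqP ->.
by rewrite opprD addrACA subrr addr0.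
Qed.

End NearlySasakian.

(** * Vanishing of the metric on [D0] and the contradiction *)

Theorem theorem4p4 (R : realType) (n : nat) (Mb : nearly_sasakian R n) :
  ~ exists M : lightlike_submanifold (@ns_g R n Mb),
      proper_qgcr M /\ xi_normal M.
Proof.
move=> [M [[D1 [D2 [D0 [Dbar [L [S [Q [x D0x] _ _ _]]]]]]] xiN]].
set f := @ll_map _ _ _ _ M in Q D0x.
have [sf _ _] := ll_immersion M.
have eta0 q w : w \in tangent_image f q -> ns_eta (f q) w = 0.
  by move=> wT; rewrite -ns_eta_g ns_g_sym; exact: (mem_orth _ _ _ (xiN q)).
have D0T w : w \in D0 x -> w \in tangent_image f x.
  move=> wD; rewrite -[tangent_image f x]/(ll_T x) -(ll_screen_complement x).1.
  rewrite -(qgcr_screen Q); apply: (subvP (addvSr _ _)).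
  exact: (subvP (addvSr _ _)).
have phiD0 w : w \in D0 x -> ns_phi (f x) w \in D0 x.
  move=> wD; apply: (subvP (qgcr_phi_D0 Q x)); exact: memv_img.
have null w : w \in D0 x -> ns_g (f x) w w = 0.
  move=> wD; have pD := phiD0 _ wD.
  have := annihilating_form_closed sf (@ns_eta_smooth _ _ Mb) eta0
    (D0T _ wD) (D0T _ pD).
  move=> /eqP; rewrite -subr_eq0 d_eta g_nabla_xi_phi ?eta0 ?D0T//.
  (* The same identity at [phi w], where applying [phi] again gives [- w], supplies the other term
     of [d_eta]. *)
  have := g_nabla_xi_phi (eta0 _ _ (D0T _ pD)).
  rewrite ns_phi2 eta0 ?D0T// scale0r addr0 linearN/= => /eqP.
  rewrite eqr_opp => /eqP ->.
  rewrite ns_compatible eta0 ?D0T// mulr0 subr0 -opprD oppr_eq0 -mulr2n.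
  by rewrite mulrn_eq0/= => /eqP.
move/negP: D0x; apply; rewrite -subv0 -(qgcr_D0_nondegenerate Q x) subv_cap subvv/=.
apply/subvP => w wD; apply/mem_orth => u uD.
(* Polarization: all vectors of [D0 x] being null, the metric vanishes on pairs of them. *)
have := null _ (memvD uD wD); rewrite !linearD/= !add_lfunE !null// add0r addr0.
rewrite [ns_g _ w u]ns_g_sym -mulr2n => /eqP.
by rewrite mulrn_eq0/= => /eqP.
Qed.
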